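(* Let $a, b$ be positive real numbers. Then $$\int_{0}^{1} x^{a-1} (1-x)^{b-1} \, \ln x \, dx = \frac{\Gamma(a) \, \Gamma(b)}{\Gamma(a+b)} \left( \psi(a) - \psi(a+b) \right).$$
   Context: $\Gamma(x)=\int_0^\infty t^{x-1}e^{-t}\,dt$ for $x>0$ is the gamma function, and $\psi$ denotes the digamma function, $\psi(x) = \frac{d}{dx}\log\Gamma(x) = \Gamma'(x)/\Gamma(x)$. *)

(* Defs.v *)
From mathcomp Require Export all_boot all_order all_algebra.
From mathcomp Require Export all_classical all_reals all_analysis.

Set Implicit Arguments.
Unset Strict Implicit.
Unset Printing Implicit Defensive.

Import GRing.Theory Num.Theory.
Import numFieldNormedType.Exports.

Local Open Scope classical_set_scope.
Local Open Scope ring_scope.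

(* Only meaningful for 0 < x: elsewhere the integral diverges and its real
   part [fine +oo] is 0. *)
Definition Gamma (R : realType) (x : R) : R :=
  \int[@lebesgue_measure R]_(t in `]0, +oo[) (t `^ (x - 1) * expR (- t)).

Definition digamma (R : realType) (x : R) : R :=
  derive1 (fun y : R => ln (Gamma y)) x.

(* Main.v *)
Require Import Defs.
From mathcomp Require Import measurable_realfun ring lra.

(** The integral is the derivative at [a] of the beta integral
    [B c = \int_0^1 x^(c-1) (1-x)^(b-1) dx], so the formula follows by
    differentiating [Gamma (c + b) * B c = Gamma c * Gamma b] at [c = a] and
    dividing by [Gamma (a + b)]; the digamma function enters through
    [Gamma' = Gamma * digamma].

    The relation between [B] and [Gamma] ([Gamma_mul_Gamma]) comes from
    integrating [s^(a+b-1) v^(a-1) e^(-s(1+v))] over the positive quadrant in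
    both orders. For fixed [s] the substitution [t = s v] produces
    [Gamma a s^(b-1) e^(-s)]; for fixed [v] rescaling [s] by [1 + v] produces
    [Gamma (a+b) v^(a-1) (1+v)^(-a-b)], and [x = v / (1 + v)] turns the
    remaining integral over [v] into [B a]. These substitutions are instances
    of [ge0_integration_by_substitution0y], which allows integrands that are
    singular at the ends of the interval.

    Both [B] and [Gamma] have the form [c |-> \int_D t^(c-1) w(t) dt], with
    [D] inside the half-line, and converge for all [c > 0]. Such a transform
    can be differentiated under the integral sign ([mellin_derivative]):
    [|ln t|] is at most [(t^(-p) + t^p) / p] for every [p > 0], so near [a] the
    [c]-derivative of the integrand is dominated by a multiple of the sum of
    the integrands at two other exponents, [a/4] and [7a/4]. *)

Set Implicit Arguments.
Unset Strict Implicit.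
Unset Printing Implicit Defensive.

Import Order.TTheory GRing.Theory Num.Theory.
Import numFieldNormedType.Exports.

Local Open Scope classical_set_scope.
Local Open Scope ring_scope.

(** * Change of variables on the half-line *)

Lemma bigcup_inv_itv (R : realType) :
  \bigcup_n `[n.+1%:R^-1, n.+1%:R]%classic = `]0, +oo[%classic :> set R.
Proof.
apply/seteqP; split=> [x [n _]|x]; rewrite /= !in_itv/= ?andbT.
  by case/andP=> + _; apply: lt_le_trans; rewrite invr_gt0.
move=> x0; exists (maxn (Num.truncn x) (Num.truncn x^-1)) => //=.
rewrite in_itv/=; apply/andP; split.
  rewrite invf_ple ?posrE//; apply: ltW.
  apply: (lt_le_trans (truncnS_gt _)).
  by rewrite ler_nat ltnS leq_maxr.
by apply: ltW; apply: (lt_le_trans (truncnS_gt _)); rewrite ler_nat ltnS leq_maxl.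
Qed.

(** The segments [1/(n+1), n+1] exhaust the half-line and their images exhaust
    the image, so monotone convergence reduces the claim to the substitution
    rule on segments. This is why nothing is asked of [F], [f] and [G] at the
    ends of the two intervals. *)
Lemma ge0_integration_by_substitution0y (R : realType) (F f G : R -> R) :
  (forall x y : R, 0 < x -> x < y -> F x < F y) ->
  (forall x : R, 0 < x -> is_derive x 1 F (f x)) ->
  (forall x : R, 0 < x -> {for x, continuous f}) ->
  (forall x : R, 0 < x -> {for F x, continuous G}) ->
  (forall x : R, 0 < x -> 0 <= G (F x)) ->
  (\int[@lebesgue_measure R]_(y in F @` `]0%R, +oo[) (G y)%:E =
   \int[@lebesgue_measure R]_(x in `]0%R, +oo[) (G (F x) * f x)%:E)%E.
Proof.
move=> Finc dF cf cG G0.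
pose K (n : nat) : set R := `[n.+1%:R^-1, n.+1%:R]%classic.
have K0 n x : K n x -> 0 < x.
  by rewrite /K/= in_itv/= => /andP[+ _]; apply: lt_le_trans; rewrite invr_gt0.
have iK n : n.+1%:R^-1 <= n.+1%:R :> R.
  by rewrite (@le_trans _ _ 1)// ?invf_le1 ?ler1n.
have cF (x : R) : 0 < x -> {for x, continuous F}.
  by move=> x0; apply/differentiable_continuous/derivable1_diffP; case: (dF _ x0).
have Fle (x y : R) : 0 < x -> x <= y -> F x <= F y.
  by move=> x0; rewrite le_eqVlt => /predU1P[->//|xy]; apply/ltW/Finc.
have wK n (h : R -> R) : (forall x : R, 0 < x -> {for x, continuous h}) ->
    {within K n, continuous h}.
  by move=> ch; apply: continuous_in_subspaceT => x; rewrite inE => /K0/ch.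
have FK n : F @` K n = `[F n.+1%:R^-1, F n.+1%:R]%classic.
  apply/seteqP; split=> [_ [x Kx <-]|y yF] /=.
    move: (Kx); rewrite /K/= !in_itv/= => /andP[x1 x2].
    by rewrite !Fle// ?(K0 n)// invr_gt0.
  have Fab : F n.+1%:R^-1 <= F n.+1%:R by rewrite Fle// invr_gt0.
  exact: (segment_continuous_le_surjective (iK n) Fab (wK n F cF) yF).
have dFE (x : R) : 0 < x -> derive1 F x = f x.
  by move=> x0; rewrite derive1E; have [_ ->] := dF _ x0.
have cdF (x : R) : 0 < x -> {for x, continuous (derive1 F)}.
  move=> x0; rewrite /prop_for /continuous_at dFE//.
  apply: cvg_trans (cf _ x0); apply: near_eq_cvg; near=> y.
  rewrite dFE//; near: y; exact: lt_nbhsr.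
have ndK : nondecreasing_seq K.
  apply/nondecreasing_seqP => n; apply/subsetPset => x.
  rewrite /K/= !in_itv/= => /andP[x1 x2]; apply/andP; split.
    by rewrite (le_trans _ x1)// lef_pV2 ?posrE// ler_nat.
  by rewrite (le_trans x2)// ler_nat.
have cGn n y : (F @` K n) y -> {for y, continuous G}.
  by move=> -[x /K0 x0 <-]; exact: cG.
have subK n : (\int[@lebesgue_measure R]_(y in F @` K n) (G y)%:E =
    \int[@lebesgue_measure R]_(x in K n) (G (F x) * f x)%:E)%E.
  rewrite FK integration_by_substitution_increasing//.
  - apply: eq_integral => x; rewrite inE => /K0 x0 /=.
    by rewrite !fctE/= dFE.
  - by move=> x y /(K0 n) x0 _; exact: Finc.
  - by move=> x /subset_itv_oo_cc/(K0 n)/cdF.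
  - by apply/cvg_ex; exists (derive1 F n.+1%:R^-1); apply: cvg_at_right_filter;
      apply: cdF; rewrite invr_gt0.
  - by apply/cvg_ex; exists (derive1 F n.+1%:R); apply: cvg_at_left_filter; apply: cdF.
  - split.
    + by move=> x /subset_itv_oo_cc/(K0 n)/dF[].
    + by apply: cvg_at_right_filter; apply: cF; rewrite invr_gt0.
    + by apply: cvg_at_left_filter; apply: cF.
  - rewrite -FK; apply: continuous_in_subspaceT => x; rewrite inE.
    exact: cGn.
have lhs : (\int[@lebesgue_measure R]_(y in F @` K n) (G y)%:E @[n --> \oo] -->
    \int[@lebesgue_measure R]_(y in \bigcup_n (F @` K n)) (G y)%:E)%E.
  apply: ge0_nondecreasing_set_cvg_integral => //.
  - by move=> m n mn; apply/subsetPset/image_subset/subsetPset/ndK.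
  - by move=> n; rewrite FK.
  - move=> n; rewrite FK; apply/measurable_EFinP.
    apply: subspace_continuous_measurable_fun => //.
    by rewrite -FK; apply: continuous_in_subspaceT => x; rewrite inE; exact: cGn.
  - by move=> n _ [x /K0 x0 <-]; rewrite lee_fin G0.
have rhs : (\int[@lebesgue_measure R]_(x in K n) (G (F x) * f x)%:E @[n --> \oo]
    --> \int[@lebesgue_measure R]_(x in \bigcup_n K n) (G (F x) * f x)%:E)%E.
  apply: ge0_nondecreasing_set_cvg_integral => //.
  - by move=> n; exact: measurable_itv.
  - move=> n; apply/measurable_EFinP.
    apply: subspace_continuous_measurable_fun; first exact: measurable_itv.
    apply: wK => x x0; apply: continuousM; last exact: cf.
    by apply: continuous_comp; [exact: cF|exact: cG].
  - move=> n x /K0 x0; rewrite lee_fin mulr_ge0 ?G0// -dFE//.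
    apply: (@incr_derive1_ge0_itvy _ _ false 0); last by rewrite in_itv/= x0.
    + by move=> y; rewrite inE/= in_itv/= andbT => /dF[].
    + by move=> y z; rewrite !in_itv/= andbT => y0 _; exact: Finc.
rewrite -bigcup_inv_itv image_bigcup -(cvg_lim _ lhs)// -(cvg_lim _ rhs)//.
by under eq_fun do rewrite subK.
Unshelve. all: end_near. Qed.

(** * The map from odds to probabilities and convergence of the gamma integral *)

Section beta_prime_map.
Context {R : realType}.
Implicit Types t x y v : R.

(** The inverse of [x |-> x / (1 - x)], hence a bijection from the half-line
    onto the open unit interval. *)
Definition odds_inv v : R := v / (1 + v).

Lemma odds_inv_itv v : 0 < v -> 0 < odds_inv v < 1.
Proof.
move=> v0; have v10 : 0 < 1 + v by rewrite addr_gt0.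
by rewrite /odds_inv divr_gt0//= ltr_pdivrMr// mul1r ltrDr.
Qed.

Lemma odds_invK y : 0 < y < 1 -> odds_inv (y / (1 - y)) = y.
Proof.
move=> /andP[y0 y1]; have y10 : 1 - y != 0 by rewrite subr_eq0 gt_eqF.
by rewrite /odds_inv; field; rewrite y10 /= subrK oner_neq0.
Qed.

Lemma onem_odds_inv v : 0 < v -> 1 - odds_inv v = (1 + v)^-1.
Proof.
move=> v0; have v10 : 1 + v != 0 by rewrite gt_eqF// addr_gt0.
by rewrite /odds_inv; field.
Qed.

Lemma odds_inv_lt v w : 0 < v -> v < w -> odds_inv v < odds_inv w.
Proof.
move=> v0 vw; rewrite -subr_gt0.
have v10 : 0 < 1 + v by rewrite addr_gt0.
have w10 : 0 < 1 + w by rewrite addr_gt0// (lt_trans v0).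
have -> : odds_inv w - odds_inv v = (w - v) / ((1 + v) * (1 + w)).
  by rewrite /odds_inv; field; rewrite !gt_eqF.
by rewrite divr_gt0 ?subr_gt0 ?mulr_gt0.
Qed.

Lemma image_odds_inv : odds_inv @` `]0, +oo[ = `]0, 1[%classic.
Proof.
apply/seteqP; split=> [_ [v + <-]|y]; rewrite /= !in_itv/= ?andbT.
  exact: odds_inv_itv.
move=> y01; exists (y / (1 - y)); last exact: odds_invK.
by case/andP: y01 => y0 y1; rewrite in_itv/= andbT divr_gt0// subr_gt0.
Qed.

Lemma is_derive_odds_inv v : 0 < v -> is_derive v 1 odds_inv ((1 + v) ^- 2).
Proof.
move=> v0; have v10 : 1 + v != 0 by rewrite gt_eqF// addr_gt0.
have d1 : is_derive v 1 (cst 1 + id : R -> R) 1.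
  by apply: is_derive_eq; rewrite add0r.
have dV := @is_deriveV _ _ _ _ _ v10 d1.
have := is_deriveM (is_derive_id v 1) dV.
move=> h; apply: (is_derive_eq h); rewrite /GRing.scale/=; by field.
Qed.

(** The constant is the best one: [t^p e^(-t)] is maximal at [t = p]. The
    inequality is [ln (t / p) <= t / p - 1]. *)
Lemma powR_le_expR p t : 0 < p -> 0 < t ->
  t `^ p <= expR (p * ln p - p) * expR t.
Proof.
move=> p0 t0; rewrite /powR gt_eqF// -expRD ler_expR.
have tp0 : 0 < t / p by rewrite divr_gt0.
have := @le_ln1Dx R (t / p - 1).
rewrite ltrBrDl subrr => /(_ tp0); rewrite subrKC ln_div ?posrE//.
move=> /(ler_wpM2l (ltW p0)); rewrite !mulrBr mulrCA divff ?gt_eqF//.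
lra.
Qed.

Lemma continuous_powR a t : 0 < t -> {for t, continuous (fun u : R => u `^ a)}.
Proof.
move=> t0; apply/differentiable_continuous/derivable1_diffP.
by case: (is_derive1_powR a t0).
Qed.

Lemma continuous_odds_inv t : 0 < t -> {for t, continuous odds_inv}.
Proof.
move=> t0; apply/differentiable_continuous/derivable1_diffP.
by case: (is_derive_odds_inv t0).
Qed.

Lemma continuous_oneD_expV (n : nat) t : 0 < t ->
  {for t, continuous (fun u : R => (1 + u) ^- n)}.
Proof.
move=> t0; apply: continuousV.
  by rewrite expf_neq0// gt_eqF// addr_gt0.
apply: (@continuous_comp _ _ _ (fun u : R => 1 + u) (fun u => u ^+ n)).
  by apply: continuousD; [exact: cvg_cst|exact: cvg_id].
exact: exprn_continuous.
Qed.

Lemma measurable_gamma_fun x (D : set R) :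
  measurable_fun D (fun t => t `^ (x - 1) * expR (- t)).
Proof.
apply: measurable_funTS; apply: measurable_funM => //.
by apply: measurableT_comp => //; exact: measurableT_comp.
Qed.

(** The integrand is at most a constant times the derivative of
    [F t = (t / (1 + t))^x], which behaves like [t^(x-1)] near [0] and decays
    like [t^(-2)] at infinity; that derivative has integral [1] because [F]
    maps the half-line onto the open unit interval. *)
Lemma gamma_integral_lty x : 0 < x ->
  (\int[@lebesgue_measure R]_(t in `]0%R, +oo[)
     (t `^ (x - 1) * expR (- t))%:E < +oo)%E.
Proof.
move=> x0; have x10 : 0 < x + 1 by rewrite addr_gt0.
pose F t := odds_inv t `^ x.
pose g t := x * odds_inv t `^ (x - 1) * (1 + t) ^- 2.
have h0 t : 0 < t -> 0 < odds_inv t by move=> /odds_inv_itv/andP[].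
have g0 t : 0 < t -> 0 <= g t.
  by move=> t0; rewrite /g !mulr_ge0 ?powR_ge0 ?invr_ge0 ?exprn_ge0 ?addr_ge0 ?ltW.
have cg t : 0 < t -> {for t, continuous g}.
  move=> t0; apply: (@continuousM _ _ (fun t => x * odds_inv t `^ (x - 1))
    (fun t => (1 + t) ^- 2)); last exact: continuous_oneD_expV.
  apply: (@continuousM _ _ (fun=> x)); first exact: cvg_cst.
  apply: (@continuous_comp _ _ _ odds_inv (fun u => u `^ (x - 1))).
    exact: continuous_odds_inv.
  by apply: continuous_powR; exact: h0.
have p1 z : (1 : R) `^ z = 1 by rewrite powR1.
have FI : F @` `]0, +oo[ = `]0, 1[%classic.
  rewrite /F -(image_comp odds_inv (fun u => u `^ x)) image_odds_inv.
  apply/seteqP; split=> [_ [y + <-]|y]; rewrite /= !in_itv/= => /andP[y0 y1].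
    rewrite powR_gt0//= -[ltRHS](p1 x).
    by rewrite gt0_ltr_powR ?nnegrE// ltW.
  exists (y `^ x^-1); last first.
    by rewrite -powRrM mulVf ?gt_eqF// powRr1// ltW.
  rewrite in_itv/= powR_gt0//= -[ltRHS](p1 x^-1).
  by rewrite gt0_ltr_powR ?nnegrE ?invr_gt0// ltW.
have mg : measurable_fun (`]0, +oo[%classic : set R) g.
  apply: open_continuous_measurable_fun => // t.
  by rewrite inE/= in_itv/= andbT => /cg.
have Finc t u : 0 < t -> t < u -> F t < F u.
  move=> t0 tu; have u0 := lt_trans t0 tu.
  by rewrite /F gt0_ltr_powR ?nnegrE ?odds_inv_lt// ltW// h0.
have dF t : 0 < t -> is_derive t 1 F (g t).
  move=> t0; have dh := is_derive1_powR x (h0 _ t0).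
  exact: (@is_derive1_comp _ (fun u => u `^ x) odds_inv _ _ _ dh
    (is_derive_odds_inv t0)).
have ig : (\int[@lebesgue_measure R]_(t in `]0%R, +oo[) (g t)%:E = 1)%E.
  under eq_integral do rewrite -[g _]mul1r.
  rewrite -(ge0_integration_by_substitution0y (G := fun=> 1) Finc dF)//.
    by rewrite FI integral_cst//= lebesgue_measure_itv/= lte_fin ltr01 oppr0 adde0 mule1.
  by move=> t _; exact: cvg_cst.
(* [powR_le_expR] at exponent [x + 1] and point [1 + t]; dividing by [x]
   cancels the factor [x] in [g]. *)
pose C := expR ((x + 1) * ln (x + 1) - (x + 1)) * expR 1 / x.
have C0 : 0 <= C by rewrite divr_ge0 ?mulr_ge0 ?expR_ge0 ?ltW.
apply: (@le_lt_trans _ _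
  (\int[@lebesgue_measure R]_(t in `]0%R, +oo[) (C%:E * (g t)%:E))%E).
  apply: ge0_le_integral => //.
  - by move=> t _; rewrite lee_fin mulr_ge0 ?powR_ge0 ?expR_ge0.
  - apply/measurable_EFinP. exact: measurable_gamma_fun.
  - by apply/measurable_EFinP; apply: measurable_funM.
  move=> t; rewrite /= in_itv/= andbT => t0; rewrite lee_fin.
  have t10 : 0 < 1 + t by rewrite addr_gt0.
  have := powR_le_expR x10 t10; rewrite (expRD 1 t) => le1.
  have -> : t `^ (x - 1) * expR (- t) =
      odds_inv t `^ (x - 1) * (1 + t) ^- 2 * ((1 + t) `^ (x + 1) * expR (- t)).
    have -> : x + 1 = (x - 1) + 2 by ring.
    rewrite (@powRD _ (1 + t)); last by apply/implyP => _; rewrite gt_eqF.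
    have -> : t `^ (x - 1) = odds_inv t `^ (x - 1) * (1 + t) `^ (x - 1).
      by rewrite -powRM ?ltW ?h0// mulfVK ?gt_eqF.
    have -> : (1 + t) `^ 2 = (1 + t) ^+ 2 by rewrite powR_mulrn ?ltW.
    by field; rewrite gt_eqF.
  have -> : C * g t = odds_inv t `^ (x - 1) * (1 + t) ^- 2 *
      (expR ((x + 1) * ln (x + 1) - (x + 1)) * expR 1).
    by rewrite /C /g; field; rewrite !gt_eqF.
  apply: ler_wpM2l; first by rewrite mulr_ge0 ?powR_ge0 ?invr_ge0 ?exprn_ge0 ?ltW.
  rewrite expRN ler_pdivrMr ?expR_gt0//.
  by rewrite -mulrA.
rewrite ge0_integralZl//.
- by rewrite ig mule1 ltry.
- exact/measurable_EFinP.
- by move=> t; rewrite /= in_itv/= andbT => t0; rewrite lee_fin g0.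
Qed.

End beta_prime_map.

(** * Differentiation of Mellin transforms *)

Section mellin.
Context {R : realType}.
Implicit Types a c d p q r t : R.

(** Both bounds are [1 + y <= e^y], at [y = d ln t] and [y = - d ln t]. *)
Lemma normr_ln_le d t : 0 < d -> 0 < t ->
  `|ln t| <= d^-1 * (t `^ (- d) + t `^ d).
Proof.
move=> d0 t0.
rewrite ler_pdivlMl// /powR gt_eqF// -{1}(gtr0_norm d0) -normrM mulNr.
have h1 := expR_ge1Dx (d * ln t); have h2 := expR_ge1Dx (- (d * ln t)).
have h3 := expR_ge0 (d * ln t); have h4 := expR_ge0 (- (d * ln t)).
by rewrite ler_norml; apply/andP; split; lra.
Qed.

(** The exponent for which [t^_] is largest depends on the position of [t]
    relative to [1]; the sum covers both cases. *)
Lemma powR_le_endpoints p q r t : 0 < t -> p <= q -> q <= r ->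
  t `^ q <= t `^ p + t `^ r.
Proof.
move=> t0 pq qr; have [t1|t1] := lerP t 1.
  by apply: ler_wpDr; [exact: powR_ge0|rewrite ger_powR// t0].
by apply: ler_wpDl; [exact: powR_ge0|rewrite ler_powR// ltW].
Qed.

Lemma is_derive_powR_exponent t c : 0 < t ->
  is_derive c 1 (fun c : R => t `^ (c - 1)) (t `^ (c - 1) * ln t).
Proof.
move=> t0.
have -> : (fun c : R => t `^ (c - 1)) = (fun c => expR (ln t * (c - 1))).
  by apply/funext => x; rewrite /powR gt_eqF// mulrC.
rewrite /powR gt_eqF// [(c - 1) * _]mulrC.
have h : is_derive c 1 (fun c : R => ln t *: (id - cst 1 : R -> R) c) (ln t).
  by apply: is_derive_eq; rewrite subr0 /GRing.scale/= mulr1.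
have := @is_derive1_comp _ expR _ _ _ _ (is_derive_expR _) h.
exact.
Qed.

Local Notation mu := (@lebesgue_measure R).

(** Since convergence is assumed at every positive exponent, the integrands at
    other exponents supply the dominating function. With [p = a/4] and
    [a/2 < c < 3a/2], bounding [|ln t|] by [(t^(-p) + t^p) / p] gives exponents
    [c - p] and [c + p], which stay between [p] and [q = 7a/4]. *)
Lemma mellin_derivative (D : set R) (w : R -> R) a :
  measurable D -> D `<=` `]0, +oo[ ->
  (forall c, 0 < c -> mu.-integrable D (fun t => (t `^ (c - 1) * w t)%:E)) ->
  0 < a ->
  mu.-integrable D (fun t => (t `^ (a - 1) * w t * ln t)%:E) /\
  is_derive a 1 (fun c : R => \int[mu]_(t in D) (t `^ (c - 1) * w t))
    (\int[mu]_(t in D) (t `^ (a - 1) * w t * ln t)).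
Proof.
move=> mD D0 iw a0.
have Dgt0 t : D t -> 0 < t by move=> /D0; rewrite /= in_itv/= andbT.
pose f c t := t `^ (c - 1) * w t.
pose p := a / 4; pose q := 7 * a / 4.
pose K := 2 * p^-1.
pose G t := K * (`|f p t| + `|f q t|).
have p0 : 0 < p by rewrite /p; lra.
have q0 : 0 < q by rewrite /q; lra.
have K0 : 0 <= K by rewrite /K mulr_ge0// invr_ge0 ltW.
have df t c : 0 < t -> is_derive c 1 (f ^~ t) (t `^ (c - 1) * w t * ln t).
  move=> t0; have h := is_derive_powR_exponent c t0.
  have -> : f ^~ t = (fun c => w t *: t `^ (c - 1)).
    by apply/funext => x; rewrite /f mulrC.
  by apply: is_derive_eq; rewrite /GRing.scale/=; ring.
have d1f t c : 0 < t -> partial1of2 f c t = t `^ (c - 1) * w t * ln t.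
  by move=> t0; rewrite partial1of2E; have [_ ->] := df t c t0.
have iG : mu.-integrable D (EFin \o G).
  rewrite (_ : EFin \o G = fun t => (K%:E * (`|(f p t)%:E| + `|(f q t)%:E|))%E)//.
  apply: integrableZl => //; apply: integrableD => //;
    by apply: integrable_abse; exact: iw.
pose u := a / 2; pose v := 3 * a / 2.
have Gub c t : `]u, v[%classic c -> D t -> `|partial1of2 f c t| <= G t.
  rewrite /= in_itv/= /u /v => /andP[uc cv] /Dgt0 t0; rewrite d1f//.
  rewrite /G /f !normrM !(ger0_norm (powR_ge0 _ _)).
  rewrite mulrAC -mulrDl mulrA ler_wpM2r//.
  have hl := normr_ln_le p0 t0.
  have sh e : t `^ (c - 1) * t `^ e = t `^ (c + e - 1).
    rewrite -powRD; last by apply/implyP => _; rewrite gt_eqF.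
    by congr (_ `^ _); ring.
  apply: (le_trans (ler_wpM2l (powR_ge0 _ _) hl)).
  rewrite mulrCA mulrDr !sh /K [2 * _]mulrC -mulrA.
  apply: ler_wpM2l; first by rewrite invr_ge0 ltW.
  have b e : - p <= e -> e <= p ->
      t `^ (c + e - 1) <= t `^ (p - 1) + t `^ (q - 1).
    by move=> e1 e2; apply: powR_le_endpoints => //; rewrite /p /q in e1 e2 *; lra.
  have pp : - p <= p by lra.
  by have := b _ (lexx _) pp; have := b _ pp (lexx _); lra.
have ua : `]u, v[%classic a by rewrite /= in_itv/= /u /v; apply/andP; split; lra.
have G0 t : 0 <= G t by rewrite /G mulr_ge0 ?addr_ge0.
have intf c : `]u, v[%classic c -> mu.-integrable D (EFin \o f c).
  rewrite /= in_itv/= => /andP[uc _]; apply: iw; apply: lt_trans uc.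
  by rewrite /u; lra.
have dff c t : `]u, v[%classic c -> D t -> derivable (f ^~ t) c 1.
  by move=> _ /Dgt0/(df t c)[].
have eqd : \int[mu]_(t in D) partial1of2 f a t =
    \int[mu]_(t in D) (t `^ (a - 1) * w t * ln t).
  by apply: eq_Rintegral => t; rewrite inE => /Dgt0 t0; exact: d1f.
split.
  apply: le_integrable iG => //.
    have /integrableP[+ _] := iw a a0 => /measurable_EFinP mf.
    apply/measurable_EFinP; apply: measurable_funM => //.
    exact: measurable_funTS.
  move=> t Dt /=; rewrite lee_fin -(d1f _ _ (Dgt0 _ Dt)).
  by rewrite [leRHS]ger0_norm// Gub.
split.
  exact: (@derivable_under_integral _ _ _ mu f D mD a u v ua intf dff G G0 iG Gub).
rewrite -derive1E.
by rewrite (@differentiation_under_integral _ _ _ mu f D mD a u v ua intf dff G G0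
  iG Gub).
Qed.

End mellin.

(** * Beta in terms of gamma *)

Section gamma_beta.
Context {R : realType}.
Implicit Types a b s t u v x : R.
Local Notation mu := (@lebesgue_measure R).

Lemma tonelli_setX (D1 D2 : set R) (f : R * R -> \bar R) :
  measurable D1 -> measurable D2 -> measurable_fun setT f ->
  (forall z, 0 <= f z)%E ->
  (\int[mu]_(x in D1) \int[mu]_(y in D2) f (x, y) =
   \int[mu]_(y in D2) \int[mu]_(x in D1) f (x, y))%E.
Proof.
move=> mD1 mD2 mf f0.
pose g := f \_ (D1 `*` D2).
have mg : measurable_fun setT g.
  apply/(measurable_restrictT f (measurableX mD1 mD2)).
  exact: measurable_funTS.
have g0 z : (0 <= g z)%E by apply: erestrict_ge0.
have := @fubini_tonelli _ _ _ _ R mu mu g mg g0.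
have gl x : (\int[mu]_y g (x, y) =
    ((fun x => \int[mu]_(y in D2) f (x, y)) \_ D1) x)%E.
  rewrite patchE; case: ifPn => xD1; last first.
    apply: integral0_eq => y _; rewrite /g patchE ifF//.
    by apply/negbTE; rewrite in_setX negb_and xD1.
  rewrite [RHS]integral_mkcond; apply: eq_integral => y _.
  by rewrite /g !patchE in_setX xD1.
have gr y : (\int[mu]_x g (x, y) =
    ((fun y => \int[mu]_(x in D1) f (x, y)) \_ D2) y)%E.
  rewrite patchE; case: ifPn => yD2; last first.
    apply: integral0_eq => x _; rewrite /g patchE ifF//.
    by apply/negbTE; rewrite in_setX negb_and yD2 orbT.
  rewrite [RHS]integral_mkcond; apply: eq_integral => x _.
  by rewrite /g !patchE in_setX yD2 andbT.
under eq_integral do rewrite gl.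
under [X in _ = X -> _]eq_integral do rewrite gr.
by rewrite -!integral_mkcond.
Qed.

(** [Gamma] is the real part of an extended real integral, so the equality
    depends on that integral being finite. *)
Lemma GammaE x : 0 < x ->
  ((Gamma x)%:E = \int[mu]_(t in `]0%R, +oo[) (t `^ (x - 1) * expR (- t))%:E)%E.
Proof.
move=> x0; rewrite /Gamma fineK// ge0_fin_numE ?gamma_integral_lty//.
by apply: integral_ge0 => t _; rewrite lee_fin mulr_ge0 ?powR_ge0 ?expR_ge0.
Qed.

Lemma gamma_integrable x : 0 < x ->
  mu.-integrable `]0%R, +oo[ (fun t => (t `^ (x - 1) * expR (- t))%:E).
Proof.
move=> x0; apply/integrableP; split.
  by apply/measurable_EFinP; exact: measurable_gamma_fun.
under eq_integral do rewrite gee0_abs ?lee_fin ?mulr_ge0 ?powR_ge0 ?expR_ge0//.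
exact: gamma_integral_lty.
Qed.

Lemma continuous_gamma_fun x t : 0 < t ->
  {for t, continuous (fun t : R => t `^ (x - 1) * expR (- t))}.
Proof.
move=> t0; apply: (@continuousM _ _ (fun t : R => t `^ (x - 1)) (fun t => expR (- t))).
  exact: continuous_powR.
apply: (@continuous_comp _ _ _ -%R expR).
  exact: continuousN.
exact: continuous_expR.
Qed.

Lemma gamma_scaling x s : 0 < x -> 0 < s ->
  (\int[mu]_(u in `]0%R, +oo[) (u `^ (x - 1) * expR (- (s * u)))%:E
   = (s `^ (- x) * Gamma x)%:E)%E.
Proof.
move=> x0 s0.
pose F u : R := s * u.
have Finc t u : 0 < t -> t < u -> F t < F u by move=> _ tu; rewrite ltr_pM2l.
have dF u : 0 < u -> is_derive u 1 F s.
  move=> _; have h := is_deriveZ s (is_derive_id u 1).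
  by apply: (is_derive_eq h); rewrite /GRing.scale/= mulr1.
have FI : F @` `]0, +oo[ = `]0, +oo[%classic.
  apply/seteqP; split=> [_ [u + <-]|u]; rewrite /= !in_itv/= !andbT => u0.
    by rewrite mulr_gt0.
  exists (u / s); last by rewrite /F mulrCA divff ?mulr1// gt_eqF.
  by rewrite in_itv/= andbT divr_gt0.
have subst := ge0_integration_by_substitution0y (f := fun=> s)
  (G := fun t => t `^ (x - 1) * expR (- t)) Finc dF.
rewrite EFinM GammaE// -[in RHS]FI subst; last 3 first.
- by move=> u _; exact: cvg_cst.
- by move=> u u0; apply: continuous_gamma_fun; rewrite mulr_gt0.
- by move=> u _; rewrite mulr_ge0 ?powR_ge0 ?expR_ge0.
rewrite -ge0_integralZl//; last 3 first.
- apply/measurable_EFinP; apply: measurable_funM => //.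
  apply: measurable_funTS.
  apply: (@measurableT_comp _ _ _ _ _ _ (fun t => t `^ (x - 1) * expR (- t))).
    exact: measurable_gamma_fun.
  by apply: measurable_funM.
- by move=> u _; rewrite lee_fin !mulr_ge0 ?powR_ge0 ?expR_ge0 ?ltW.
- by rewrite lee_fin powR_ge0.
apply: eq_integral => u; rewrite inE/= in_itv/= andbT => u0.
rewrite -EFinM; congr EFin; rewrite /F powRM ?ltW//.
have -> : s `^ (x - 1) = s `^ x / s.
  by rewrite powRD ?powR_inv1 ?ltW//; apply/implyP => _; rewrite gt_eqF.
rewrite powRN; field; rewrite ?gt_eqF ?powR_gt0//.
Qed.

End gamma_beta.

Section beta.
Context {R : realType}.
Implicit Types a b s t u v x : R.
Local Notation mu := (@lebesgue_measure R).

(** The substitution [x = v / (1 + v)], for which [1 - x = (1 + v)^-1] and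
    [dx = (1 + v)^-2 dv]. *)
Lemma beta_as_odds_integral a b :
  (\int[mu]_(x in `]0%R, 1%R[) (x `^ (a - 1) * (1 - x) `^ (b - 1))%:E =
   \int[mu]_(v in `]0%R, +oo[) (v `^ (a - 1) * (1 + v) `^ (- (a + b)))%:E)%E.
Proof.
have subst := ge0_integration_by_substitution0y
  (G := fun x => x `^ (a - 1) * (1 - x) `^ (b - 1))
  odds_inv_lt is_derive_odds_inv.
rewrite -image_odds_inv subst; last 3 first.
- by move=> v v0; exact: continuous_oneD_expV.
- move=> v /odds_inv_itv/andP[h0 h1].
  apply: (@continuousM _ _ (fun x : R => x `^ (a - 1)) (fun x => (1 - x) `^ (b - 1))).
    exact: continuous_powR.
  apply: (@continuous_comp _ _ _ (fun x : R => 1 - x) (fun x => x `^ (b - 1))).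
    by apply: continuousB; [exact: cvg_cst|exact: cvg_id].
  by apply: continuous_powR; rewrite subr_gt0.
- by move=> v _; rewrite mulr_ge0 ?powR_ge0.
apply: eq_integral => v; rewrite inE/= in_itv/= andbT => v0; congr EFin.
have v10 : 0 < 1 + v by rewrite addr_gt0.
rewrite onem_odds_inv// /odds_inv powRM ?invr_ge0 ?ltW//.
rewrite -(powR_inv1 (ltW v10)) -!powRrM -(powR_invn 2 (ltW v10)) -!mulrA.
rewrite -!powRD; try by apply/implyP => _; rewrite gt_eqF.
by congr (_ * _ `^ _); ring.
Qed.

(** Tonelli's theorem for [k (s, v) = s^(a+b-1) v^(a-1) e^(-s(1+v))] on the
    positive quadrant, with [gamma_scaling] evaluating the inner integral in
    either order. The identity is kept in the extended reals because it is
    what proves the beta integral finite. *)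
Lemma Gamma_mul_Gamma a b : 0 < a -> 0 < b ->
  ((Gamma a * Gamma b)%:E = (Gamma (a + b))%:E *
     \int[mu]_(x in `]0%R, 1%R[) (x `^ (a - 1) * (1 - x) `^ (b - 1))%:E)%E.
Proof.
move=> a0 b0; have ab0 : 0 < a + b by rewrite addr_gt0.
pose k (z : R * R) := z.1 `^ (a + b - 1) * z.2 `^ (a - 1) * expR (- (z.1 * (1 + z.2))).
have mk : measurable_fun setT (EFin \o k).
  apply/measurable_EFinP; apply: measurable_funM.
    apply: measurable_funM.
      by apply: (@measurableT_comp _ _ _ _ _ _ (fun x : R => x `^ (a + b - 1))).
    by apply: (@measurableT_comp _ _ _ _ _ _ (fun x : R => x `^ (a - 1))).
  apply: measurableT_comp => //; apply: measurableT_comp => //.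
  by apply: measurable_funM => //; apply: measurable_funD.
have k0 z : (0 <= (EFin \o k) z)%E.
  by rewrite lee_fin !mulr_ge0 ?powR_ge0 ?expR_ge0.
have Gge0 x : 0 <= Gamma x.
  by apply: Rintegral_ge0 => t _; rewrite mulr_ge0 ?powR_ge0 ?expR_ge0.
have := @tonelli_setX R `]0, +oo[ `]0, +oo[ (EFin \o k)
  (measurable_itv _) (measurable_itv _) mk k0.
set L := (X in X = _ -> _); set RH := (X in _ = X -> _).
have -> : L = (Gamma a * Gamma b)%:E.
  rewrite mulrC EFinM GammaE// [RHS]muleC -ge0_integralZl//; last 3 first.
  - by apply/measurable_EFinP; exact: measurable_gamma_fun.
  - by move=> t _; rewrite lee_fin mulr_ge0 ?powR_ge0 ?expR_ge0.
  - by rewrite lee_fin.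
  apply: eq_integral => s; rewrite inE/= in_itv/= andbT => s0.
  transitivity (\int[mu]_(v in `]0%R, +oo[) ((s `^ (a + b - 1) * expR (- s))%:E *
      (v `^ (a - 1) * expR (- (s * v)))%:E))%E.
    apply: eq_integral => v _; rewrite -EFinM; congr EFin.
    by rewrite /k/= mulrDr mulr1 opprD expRD; ring.
  rewrite ge0_integralZl//; last 3 first.
  - apply/measurable_EFinP; apply: measurable_funTS.
    apply: measurable_funM => //; apply: measurableT_comp => //.
    by apply: measurableT_comp => //; apply: measurable_funM.
  - by move=> t _; rewrite lee_fin mulr_ge0 ?powR_ge0 ?expR_ge0.
  - by rewrite lee_fin mulr_ge0 ?powR_ge0 ?expR_ge0.
  rewrite gamma_scaling// -!EFinM; congr EFin.
  have -> : s `^ (b - 1) = s `^ (a + b - 1) * s `^ (- a).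
    rewrite -powRD; last by apply/implyP => _; rewrite gt_eqF.
    by congr (_ `^ _); ring.
  by ring.
move=> ->.
rewrite beta_as_odds_integral -ge0_integralZl//; last 3 first.
- apply/measurable_EFinP; apply: measurable_funTS.
  apply: measurable_funM => //.
  apply: (@measurableT_comp _ _ _ _ _ _ (fun x => x `^ (- (a + b)))) => //.
  exact: measurable_funD.
- by move=> t _; rewrite lee_fin mulr_ge0 ?powR_ge0.
- by rewrite lee_fin.
apply: eq_integral => v; rewrite inE/= in_itv/= andbT => v0.
have v10 : 0 < 1 + v by rewrite addr_gt0.
transitivity (\int[mu]_(s in `]0%R, +oo[) ((v `^ (a - 1))%:E *
    (s `^ (a + b - 1) * expR (- ((1 + v) * s)))%:E))%E.
  apply: eq_integral => s _; rewrite -EFinM; congr EFin.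
  by rewrite /k/= [s * (1 + v)]mulrC; ring.
rewrite ge0_integralZl//; last 3 first.
- apply/measurable_EFinP; apply: measurable_funTS.
  apply: measurable_funM => //; apply: measurableT_comp => //.
  by apply: measurableT_comp => //; apply: measurable_funM.
- by move=> t _; rewrite lee_fin mulr_ge0 ?powR_ge0 ?expR_ge0.
- by rewrite lee_fin powR_ge0.
by rewrite gamma_scaling// -!EFinM; congr EFin; ring.
Qed.

(** On [1, 2] the logarithm lies between [0] and [1], so the integrand is at
    least [e^(-|x-1|) e^(-2)] there. *)
Lemma Gamma_gt0 x : 0 < x -> 0 < Gamma x.
Proof.
move=> x0.
pose m := expR (- `|x - 1|) * expR (- 2).
have m0 : 0 < m by rewrite mulr_gt0 ?expR_gt0.
apply: (lt_le_trans m0); rewrite -lee_fin GammaE//.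
have -> : (m%:E = \int[mu]_(t in `[1%R, 2%R]) (cst m%:E t))%E.
  rewrite integral_cst//= lebesgue_measure_itv/= lte_fin ltr1n.
  by rewrite -EFinD -EFinM; congr EFin; ring.
apply: (@le_trans _ _ (\int[mu]_(t in `[1%R, 2%R]) (t `^ (x - 1) * expR (- t))%:E)%E).
  apply: ge0_le_integral => //.
  - by move=> t _; rewrite lee_fin ltW.
  - by apply/measurable_EFinP; exact: measurable_gamma_fun.
  move=> t /=; rewrite in_itv/= => /andP[t1 t2]; rewrite lee_fin.
  have t0 : 0 < t by apply: lt_le_trans t1.
  apply: ler_pM; rewrite ?expR_ge0//; last by rewrite ler_expR lerN2.
  rewrite /powR gt_eqF// ler_expR lerNl.
  apply: (le_trans (ler_norm _)); rewrite normrN normrM.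
  rewrite -[leRHS]mulr1 ler_wpM2l// ger0_norm ?ln_ge0//.
  have := @le_ln1Dx R (t - 1); rewrite ltrBrDl subrr subrKC => /(_ t0); lra.
apply: ge0_subset_integral => //.
- by apply/measurable_EFinP; exact: measurable_gamma_fun.
- by move=> t _; rewrite lee_fin mulr_ge0 ?powR_ge0 ?expR_ge0.
- by move=> t /=; rewrite !in_itv/= andbT => /andP[t1 _]; apply: lt_le_trans t1.
Qed.

(** An infinite beta integral would make the right-hand side of
    [Gamma_mul_Gamma] infinite, as [Gamma (a + b) > 0]. *)
Lemma beta_integrable a b : 0 < a -> 0 < b ->
  mu.-integrable `]0%R, 1%R[ (fun x => (x `^ (a - 1) * (1 - x) `^ (b - 1))%:E).
Proof.
move=> a0 b0; apply/integrableP; split.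
  apply/measurable_EFinP; apply: measurable_funTS; apply: measurable_funM => //.
  apply: (@measurableT_comp _ _ _ _ _ _ (fun x => x `^ (b - 1))) => //.
  exact: measurable_funB.
under eq_integral do rewrite gee0_abs ?lee_fin ?mulr_ge0 ?powR_ge0//.
have := Gamma_mul_Gamma a0 b0; set I := integral _ _ _.
have G0 := Gamma_gt0 (addr_gt0 a0 b0).
have : (0 <= I)%E.
  by apply: integral_ge0 => x _; rewrite lee_fin mulr_ge0 ?powR_ge0.
clearbody I; case: I => [r|_|] //.
- by rewrite ltry.
- by rewrite gt0_muley ?lte_fin.
Qed.

End beta.

(** * The digamma function and the logarithmic beta integral *)

Section digamma.
Context {R : realType}.
Implicit Types x : R.
Local Notation mu := (@lebesgue_measure R).

Lemma derivable_Gamma x : 0 < x -> derivable (@Gamma R) x 1.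
Proof.
move=> x0.
have [_ []//] := @mellin_derivative R `]0, +oo[%classic (fun t => expR (- t)) x
  (measurable_itv _) (@subset_refl _ _) (fun c c0 => gamma_integrable c0) x0.
Qed.

Lemma is_derive_Gamma x : 0 < x ->
  is_derive x 1 (@Gamma R) (Gamma x * digamma x).
Proof.
move=> x0; have G0 := Gamma_gt0 x0.
have dG : is_derive x 1 (@Gamma R) (derive1 (@Gamma R) x).
  by rewrite derive1E; apply: derivableP; exact: derivable_Gamma.
have [_ dln] := is_derive1_comp (is_derive1_ln G0) dG.
have -> : digamma x = (Gamma x)^-1 * derive1 (@Gamma R) x.
  by rewrite -[RHS]dln -derive1E.
by rewrite mulrA divff ?mul1r// gt_eqF.
Qed.

End digamma.

Theorem proposition9p1 (R : realType) (a b : R) (ha : 0 < a) (hb : 0 < b) :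
  (\int[@lebesgue_measure R]_(x in `]0%R, 1%R[)
     (x `^ (a - 1) * (1 - x) `^ (b - 1) * ln x)%:E)%E
  = (Gamma a * Gamma b / Gamma (a + b) * (digamma a - digamma (a + b)))%:E.
Proof.
(* The differentiated relation between beta and gamma, solved for the
   logarithmic integral [L]. *)
have alg (g ga gb B L p q : R) : g * L + B * (g * q) = gb * (ga * p) ->
    g * B = ga * gb -> g != 0 -> L = ga * gb / g * (p - q).
  move=> E gB g0; apply: (mulfI g0); rewrite -gB.
  have -> : g * L = ga * gb * p - B * (g * q).
    by rewrite [ga * gb]mulrC -mulrA -E addrK.
  by rewrite -gB; field.
have hab : 0 < a + b by rewrite addr_gt0.
have sub01 : `]0%R, 1%R[ `<=` (`]0%R, +oo[%classic : set R).
  by move=> x; rewrite /= !in_itv/= andbT => /andP[].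
have [iL] := mellin_derivative (w := fun x => (1 - x) `^ (b - 1))
  (measurable_itv _) sub01 (fun c c0 => beta_integrable c0 hb) ha.
set B := (X in is_derive _ _ X _); set L := Rintegral _ _ _ => dB.
rewrite -(fineK (integrable_fin_num _ iL))// -[fine _]/L; congr EFin.
have BG c : 0 < c -> Gamma (c + b) * B c = Gamma c * Gamma b.
  move=> c0; apply: EFin_inj; rewrite Gamma_mul_Gamma// EFinM; congr (_ * _)%E.
  by rewrite /B/= fineK// integrable_fin_num//; exact: beta_integrable.
have dGs : is_derive a 1 (fun c => Gamma (c + b)) (Gamma (a + b) * digamma (a + b)).
  have h : is_derive a 1 (id + cst b : R -> R) 1.
    by apply: is_derive_eq; rewrite addr0.
  have := @is_derive1_comp _ (@Gamma R) (id + cst b) _ _ _ (is_derive_Gamma hab) h.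
  by rewrite mulr1.
have dl := is_deriveM dGs dB.
have dr := is_deriveZ (Gamma b) (is_derive_Gamma ha).
have : 'D_1 (fun c => Gamma (c + b) * B c) a = 'D_1 (fun c => Gamma b * Gamma c) a.
  apply: near_eq_derive => //; near=> c; rewrite BG; first by rewrite mulrC.
  by near: c; exact: lt_nbhsr.
have [_ ->] := dl; have [_ ->] := dr; rewrite /GRing.scale/= => E.
exact: (alg _ _ _ _ _ _ _ E (BG a ha) (lt0r_neq0 (Gamma_gt0 hab))).
Unshelve. all: end_near. Qed.
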